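(* Let $k\geq 1$ and $n\geq 0$. The Munarini graph $M_{n,k}$ is isomorphic to $\Gamma_{n,k}^\star$. In particular, if $n\geq 1$, then $M_{n,k}$ is isomorphic to a subgraph of the Fibonacci cube $\Gamma_{kn-1}$.
   Context: For integers $k\geq 1$, $n\geq 0$, a $k$-generalized Pell string of length $n$ is a word of length $n$ over the alphabet $\{0,1,\ldots,k\}$ in which every maximal run of the character $k$ has even length (equivalently, a concatenation of letters from $\{0,1,\ldots,k-1,kk\}$). Let $\mathcal{F}_{n,k}$ be the set of these strings (for $n=0$ it contains only the empty string). The Munarini graph $M_{n,k}$ is the simple graph with vertex set $\mathcal{F}_{n,k}$ in which two vertices are adjacent if one of them can be obtained from the other either by replacing one occurrence of $0$ with some $i\in\{1,\ldots,k-1\}$, or by replacing one substring $00$ (two consecutive positions) with $kk$ (both replacements may be read in either direction, and both strings must be in $\mathcal{F}_{n,k}$). The Fibonacci cube $\Gamma_m$ is the subgraph of the hypercube $Q_m$ (vertex set $\{0,1\}^m$, two strings adjacent iff they differ in exactly one coordinate) induced by the binary strings of length $m$ with no two consecutive $1$s; $\Gamma_0=K_1$. Let $A_0=0^k$ and $A_i=0^{i-1}10^{k-i}$ for $i\in\{1,\ldots,k\}$ (binary strings of length $k$). A Munarini string is a binary string that is a concatenation of zero or more strings from $\{A_0,A_1,\ldots,A_{k-1},A_kA_0\}$. Let $\mathcal{F}_{n,k}^\star$ be the set of Munarini strings of length $kn$ (they have no two consecutive $1$s), and let $\Gamma_{n,k}^\star$ be the subgraph of $\Gamma_{kn}$ induced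 by $\mathcal{F}_{n,k}^\star$. *)

(* Defs.v *)
From HB Require Import structures.
From mathcomp Require Import all_boot.

Set Implicit Arguments.
Unset Strict Implicit.
Unset Printing Implicit Defensive.

Record sgraph := SGraph {
  vertex :> finType;
  adj : rel vertex;
  adj_sym : symmetric adj;
  adj_irr : irreflexive adj }.

Definition isomorphic (G H : sgraph) : Prop :=
  exists f : G -> H, bijective f /\ forall x y, adj (f x) (f y) = adj x y.

Section Subgraphs.
Variable G : sgraph.

Section Induced.
Variable P : pred G.
Definition induced_adj : rel {x : G | P x} := fun x y => adj (val x) (val y).
Lemma induced_sym : symmetric induced_adj.
Proof. by move=> x y; apply: adj_sym. Qed.
Lemma induced_irr : irreflexive induced_adj.
Proof. by move=> x; apply: adj_irr. Qed.
Definition induced : sgraph := SGraph induced_sym induced_irr.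
End Induced.

(* Not necessarily induced: any set of vertices, with any set of edges of G   *)
(* between them.                                                              *)
Record subgraph := Subgraph {
  sub_vertices : {set G};
  sub_adj : rel G;
  sub_adj_sym : symmetric sub_adj;
  sub_adj_edge : forall x y, sub_adj x y -> adj x y;
  sub_adj_vertices :
    forall x y, sub_adj x y -> (x \in sub_vertices) && (y \in sub_vertices) }.

Section ToSgraph.
Variable H : subgraph.
Definition subgraph_adj : rel {x : G | x \in sub_vertices H} :=
  fun x y => sub_adj H (val x) (val y).
Lemma subgraph_sym : symmetric subgraph_adj.
Proof. by move=> x y; apply: sub_adj_sym. Qed.
Lemma subgraph_irr : irreflexive subgraph_adj.
Proof. by move=> x; apply/negP => /sub_adj_edge; rewrite adj_irr. Qed.
Definition sgraph_of_subgraph : sgraph := SGraph subgraph_sym subgraph_irr.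
End ToSgraph.
End Subgraphs.

Coercion sgraph_of_subgraph : subgraph >-> sgraph.

Section Munarini.
Variables n k : nat.
Implicit Types w : n.-tuple 'I_k.+1.

(* The letter k is ord_max : 'I_k.+1. The positions p with i <= p < j form a  *)
(* maximal run of it.                                                         *)
Definition max_run w (i j : nat) : bool :=
  [&& i < j,
      [forall p : 'I_n, (i <= p < j) ==> (tnth w p == ord_max)] &
      [forall p : 'I_n, (p.+1 == i) || (p == j :> nat) ==>
                        (tnth w p != ord_max)]].

Definition pell_string w : bool :=
  [forall i : 'I_n.+1, forall j : 'I_n.+1, max_run w i j ==> ~~ odd (j - i)].

Definition replace_letter : rel (n.-tuple 'I_k.+1) := fun w w' =>
  [exists p : 'I_n,
    [&& tnth w p == ord0, 0 < tnth w' p < k &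
        [forall q : 'I_n, (q != p) ==> (tnth w' q == tnth w q)]]].

Definition replace_pair : rel (n.-tuple 'I_k.+1) := fun w w' =>
  [exists p : 'I_n, exists p' : 'I_n,
    [&& p' == p.+1 :> nat,
        tnth w p == ord0, tnth w p' == ord0,
        tnth w' p == ord_max, tnth w' p' == ord_max &
        [forall q : 'I_n, (q != p) && (q != p') ==> (tnth w' q == tnth w q)]]].

Definition replace : rel (n.-tuple 'I_k.+1) :=
  fun w w' => replace_letter w w' || replace_pair w w'.

Definition munarini_adj : rel {w : n.-tuple 'I_k.+1 | pell_string w} :=
  fun x y => replace (val x) (val y) || replace (val y) (val x).

Lemma munarini_sym : symmetric munarini_adj.
Proof. by move=> x y; apply: orbC. Qed.

Lemma munarini_irr : 0 < k -> irreflexive munarini_adj.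
Proof.
move=> k_gt0 x; rewrite /munarini_adj orbb; apply/negP => /orP[].
  by case/existsP=> p /and3P[/eqP->].
case/existsP=> p /existsP[p' /and5P[_ /eqP-> _ /eqP/(congr1 val)/= k0 _]].
by rewrite -k0 in k_gt0.
Qed.

Definition munarini_graph (k_gt0 : 0 < k) : sgraph :=
  SGraph munarini_sym (munarini_irr k_gt0).
End Munarini.

Section Hypercube.
Variable m : nat.
Definition hypercube_adj : rel (m.-tuple bool) :=
  fun x y => #|[set i | tnth x i != tnth y i]| == 1.
Lemma hypercube_sym : symmetric hypercube_adj.
Proof.
move=> x y; rewrite /hypercube_adj; congr (_ == 1); apply: eq_card => i.
by rewrite !inE eq_sym.
Qed.
Lemma hypercube_irr : irreflexive hypercube_adj.
Proof.
move=> x; rewrite /hypercube_adj (_ : [set _ | _] = set0) ?cards0 //.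
by apply/setP=> i; rewrite !inE eqxx.
Qed.
Definition hypercube : sgraph := SGraph hypercube_sym hypercube_irr.

Definition fibonacci_string (x : m.-tuple bool) : bool :=
  [forall i : 'I_m, forall j : 'I_m,
    (j == i.+1 :> nat) ==> ~~ (tnth x i && tnth x j)].

Definition fibonacci_cube : sgraph := @induced hypercube fibonacci_string.
End Hypercube.

Section MunariniStrings.
Variable k : nat.

Definition A (i : nat) : seq bool :=
  if i == 0 then nseq k false else nseq i.-1 false ++ true :: nseq (k - i) false.

(* The generators A_0, ..., A_{k-1}, A_k A_0, indexed by 0, ..., k.           *)
Definition munarini_block (i : 'I_k.+1) : seq bool :=
  if i == ord_max then A k ++ A 0 else A i.

(* At most size s generators are allowed, so that the predicate is boolean;   *)
(* no generator is empty when k >= 1, so this is no restriction: see          *)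
(* munarini_stringP.                                                          *)
Definition munarini_string (s : seq bool) : bool :=
  [exists bs : {bseq (size s) of 'I_k.+1},
    s == flatten [seq munarini_block i | i <- bs]].

Lemma size_A i : 0 < k -> i <= k -> size (A i) = k.
Proof.
move=> k_gt0 ik; rewrite /A; case: eqP => [_|/eqP i0]; first by rewrite size_nseq.
rewrite size_cat /= !size_nseq addnS -addSn prednK ?lt0n //.
by rewrite subnKC.
Qed.

Lemma size_munarini_block i : 0 < k -> 0 < size (munarini_block i).
Proof.
move=> k_gt0; rewrite /munarini_block; case: ifP => _.
  by rewrite size_cat size_A // ltn_addr.
by rewrite size_A // -ltnS.
Qed.

Lemma munarini_stringP s : 0 < k ->
  reflect (exists bs : seq 'I_k.+1, s = flatten [seq munarini_block i | i <- bs])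
          (munarini_string s).
Proof.
move=> k_gt0; apply: (iffP existsP) => [[bs /eqP E]|[bs E]]; first by exists bs.
suff sz : size bs <= size s by exists (Bseq sz); apply/eqP.
rewrite {s}E; elim: bs => //= i bs IH; rewrite size_cat.
by rewrite -add1n leq_add // size_munarini_block.
Qed.
End MunariniStrings.

Lemma munarini_string_fibonacci k m (x : m.-tuple bool) :
  0 < k -> munarini_string k x -> fibonacci_string x.
Proof.
move=> k_gt0 /(munarini_stringP _ k_gt0)[bs E].
pose R (a b : bool) := ~~ (a && b).
pose good s := path R false s && ~~ last false s.
have good_nil : good [::] by [].
have good_cat s t : good s -> good t -> good (s ++ t).
  by case/andP=> ps ls /andP[pt lt]; rewrite /good cat_path last_cat ps (negPf ls) pt.
have p0 j : path R false (nseq j false) by elim: j.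
have l0 j : last false (nseq j false) = false by elim: j.
have p1 j : path R true (nseq j false) by case: j => //= j; rewrite p0.
have l1 j : last true (nseq j false) = (j == 0) by case: j => //= j; rewrite l0.
have goodA i : i < k -> good (A k i).
  move=> ik; rewrite /good /A; case: eqP => _; first by rewrite p0 l0.
  by rewrite cat_path last_cat /= p0 l0 p1 l1 /= -lt0n subn_gt0.
have goodkk : good (A k k ++ A k 0).
  rewrite /good /A eqxx -[k == 0]negbK -lt0n k_gt0 /= subnn -catA.
  rewrite cat_path p0 l0 /= p1 last_cat /= l1.
  by rewrite -lt0n.
have : good (x : seq bool).
  rewrite E; elim: bs {E} => //= i bs IH; apply: good_cat => //.
  rewrite /munarini_block; case: eqP => // /eqP i_max; apply: goodA.
  by rewrite ltn_neqAle -ltnS ltn_ord andbT.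
case/andP=> /(pathP false) Px _; apply/forallP=> i; apply/forallP=> j.
apply/implyP=> /eqP ij; have := Px j; rewrite size_tuple ltn_ord => /(_ isT).
by rewrite ij /= -ij !(tnth_nth false).
Qed.

Definition munarini_subcube (n k : nat) : sgraph :=
  @induced (fibonacci_cube (k * n))
           (fun x => munarini_string k (val x)).

(* Main.v *)
Require Import Defs.
From mathcomp Require Import all_boot.
From mathcomp Require Import zify.

Set Implicit Arguments.
Unset Strict Implicit.
Unset Printing Implicit Defensive.

(** Pell strings are the words in the blocks [0], ..., [k-1], [kk].  Writing
    the last block as [k0] does not change lengths, and it unifies the two kinds
    of edges: [00 -> kk] becomes [00 -> k0], so an edge replaces a single letter
    [0] by a nonzero letter.  Encoding each letter [i] by [A_i] then yields
    exactly the Munarini strings.  For distinct letters [i], [j] the Hamming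
    distance of [A_i] and [A_j] is [(i != 0) + (j != 0)], so two encoded words
    are at distance 1 exactly when they differ in one letter, which is [0] in
    one of them.  Finally every Munarini string ends with a [0], which can be
    dropped. *)

(** * Embeddings of graphs *)

Definition embedding (G H : sgraph) (f : G -> H) : Prop :=
  injective f /\ forall x y, adj (f x) (f y) = adj x y.

Lemma embedding_factor (G H K : sgraph) (f : G -> H) (h : K -> H) :
  embedding f -> embedding h -> {subset codom f <= codom h} ->
  exists2 g : G -> K, embedding g & forall x, h (g x) = f x.
Proof.
move=> [f_inj f_adj] [_ h_adj] fh.
pose g x := iinv (fh _ (codom_f f x)).
have hg x : h (g x) = f x by apply: f_iinv.
exists g => //; split=> [x y gxy|x y]; last by rewrite -h_adj !hg.
by apply: f_inj; rewrite -!hg gxy.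
Qed.

Lemma isomorphic_same_codom (G H K : sgraph) (f : G -> H) (h : K -> H) :
  embedding f -> embedding h -> codom f =i codom h -> isomorphic G K.
Proof.
move=> f_emb h_emb fh.
have [|g [g_inj g_adj] _] := embedding_factor f_emb h_emb.
  by move=> y; rewrite fh.
have [|g' [g'_inj _] _] := embedding_factor h_emb f_emb.
  by move=> y; rewrite fh.
by exists g; split=> //; apply: inj_card_bij (leq_card g' g'_inj).
Qed.

Lemma induced_embedding (G : sgraph) (P : pred G) :
  embedding (val : induced P -> G).
Proof. by split=> //; apply: val_inj. Qed.

Section InducedSubgraph.
Variables (G : sgraph) (V : {set G}).

Definition adj_within : rel G := fun x y => [&& adj x y, x \in V & y \in V].

Lemma adj_within_sym : symmetric adj_within.
Proof. by move=> x y; rewrite /adj_within adj_sym [(x \in V) && _]andbC. Qed.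

Lemma adj_within_edge x y : adj_within x y -> adj x y.
Proof. by case/and3P. Qed.

Lemma adj_within_vertices x y : adj_within x y -> (x \in V) && (y \in V).
Proof. by case/andP. Qed.

Definition induced_subgraph : subgraph G :=
  Subgraph adj_within_sym adj_within_edge adj_within_vertices.

Lemma induced_subgraph_embedding : embedding (val : induced_subgraph -> G).
Proof.
split=> [|x y]; first exact: val_inj.
by rewrite /= /subgraph_adj /= /adj_within (valP x) (valP y) !andbT.
Qed.
End InducedSubgraph.

Lemma embedding_isomorphic_subgraph (G H : sgraph) (f : G -> H) :
  embedding f -> exists S : subgraph H, isomorphic G S.
Proof.
move=> f_emb; exists (induced_subgraph [set y in codom f]).
apply: isomorphic_same_codom f_emb (induced_subgraph_embedding _) _ => y.
by rewrite codom_val inE.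
Qed.

(** * Factors of words *)

Section FactorReplace.
Variable T : Type.
Implicit Types s t u v : seq T.

Lemma cat_take_factor_drop x0 u s p : p + size u <= size s ->
  (forall i, i < size u -> nth x0 s (p + i) = nth x0 u i) ->
  s = take p s ++ u ++ drop (p + size u) s.
Proof.
move=> ps su; rewrite -[LHS](cat_take_drop p); congr (_ ++ _).
rewrite -[LHS](cat_take_drop (size u)) drop_drop [size u + p]addnC.
congr (_ ++ _).
have u_size : size (take (size u) (drop p s)) = size u.
  by rewrite size_takel // size_drop leq_subRL ?(leq_trans (leq_addr _ _) ps).
apply: (@eq_from_nth _ x0) => // i; rewrite u_size => iu.
by rewrite nth_take // nth_drop su.
Qed.

Definition factor_replace u v s t : Prop :=
  exists a c, s = a ++ u ++ c /\ t = a ++ v ++ c.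

Lemma factor_replace_tnth x0 u v n (s t : n.-tuple T) : size u = size v ->
  factor_replace u v s t <->
  exists p, [/\ p + size u <= n,
    forall i, i < size u -> nth x0 s (p + i) = nth x0 u i,
    forall i, i < size v -> nth x0 t (p + i) = nth x0 v i &
    forall q : 'I_n, ~~ (p <= q < p + size u) -> tnth t q = tnth s q].
Proof.
move=> uv; split=> [[a [c [sE tE]]]|[p [pn su tv st]]].
  exists (size a); split; rewrite ?sE ?tE.
  - by rewrite -(size_tuple s) sE !size_cat addnA leq_addr.
  - by move=> i iu; rewrite nth_cat ltnNge leq_addr addKn nth_cat iu.
  - by move=> i iv; rewrite nth_cat ltnNge leq_addr addKn nth_cat iv.
  - move=> q; rewrite !(tnth_nth x0) sE tE !nth_cat -uv.
    case: (ltnP q (size a)) => //= aq out.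
    by have -> : (q - size a < size u) = false by lia.
have eq_outside q :
    q < n -> ~~ (p <= q < p + size u) -> nth x0 t q = nth x0 s q.
  by move=> qn; have := st (Ordinal qn); rewrite !(tnth_nth x0).
have pn' : p <= n by apply: leq_trans pn; apply: leq_addr.
exists (take p s), (drop (p + size u) s); split.
  by apply: cat_take_factor_drop su; rewrite size_tuple.
rewrite {1}(cat_take_factor_drop _ tv) ?size_tuple -uv //.
congr (_ ++ (_ ++ _)); apply: (@eq_from_nth _ x0) => [|i].
- by rewrite !size_takel ?size_tuple.
- rewrite size_takel ?size_tuple // => ip; rewrite !nth_take //.
  by apply: eq_outside; lia.
- by rewrite !size_drop !size_tuple.
- by rewrite size_drop size_tuple !nth_drop => ip; apply: eq_outside; lia.
Qed.

Lemma factor_replace_cons x u v s t :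
  factor_replace u v s t -> factor_replace u v (x :: s) (x :: t).
Proof. by case=> a [c [-> ->]]; exists (x :: a), c. Qed.
End FactorReplace.

(** * Distances between words *)

Section WordDistance.
Variables (T : Type) (d : T -> T -> nat).
Implicit Types s t : seq T.

Definition word_dist s t : nat := \sum_(p <- zip s t) d p.1 p.2.

Lemma word_dist_cons x y s t :
  word_dist (x :: s) (y :: t) = d x y + word_dist s t.
Proof. by rewrite /word_dist big_cons. Qed.

Lemma word_dist_cat s1 s2 t1 t2 : size s1 = size t1 ->
  word_dist (s1 ++ s2) (t1 ++ t2) = word_dist s1 t1 + word_dist s2 t2.
Proof. by move=> sz; rewrite /word_dist zip_cat // big_cat. Qed.

Hypothesis d_eq0 : forall x y, d x y = 0 <-> x = y.

Lemma word_dist_eq0 s t : size s = size t -> word_dist s t = 0 <-> s = t.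
Proof.
elim: s t => [|x s IH] [|y t] //=; first by rewrite /word_dist big_nil.
case=> /IH eq0; rewrite word_dist_cons; split=> [/eqP|[xy st]].
  by rewrite addn_eq0 => /andP[/eqP/d_eq0-> /eqP/eq0->].
by rewrite (d_eq0 _ _).2 // eq0.2.
Qed.

Lemma word_dist_eq1 s t : size s = size t ->
  word_dist s t = 1 <->
  exists x y, d x y = 1 /\ factor_replace [:: x] [:: y] s t.
Proof.
move=> st; split=> [|[x [y [dxy [a [c [-> ->]]]]]]]; last first.
  by rewrite word_dist_cat // word_dist_cons dxy !(word_dist_eq0 _).2.
elim: s t st => [|x s IH] [|y t] //= => [_|[st]].
  by rewrite /word_dist big_nil.
rewrite word_dist_cons; case dxy: (d x y) => [|[|m]] //.
  move: dxy => /d_eq0-> /(IH _ st)[x' [y' [dxy' rep]]].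
  by exists x', y'; split=> //; apply: factor_replace_cons.
by move=> [/(word_dist_eq0 st)->]; exists x, y; split=> //; exists [::], t.
Qed.
End WordDistance.

Lemma word_dist_flatten (S T : Type) (d : T -> T -> nat) (c : S -> seq T)
    m (s t : seq S) :
  (forall x, size (c x) = m) -> size s = size t ->
  word_dist d (flatten [seq c x | x <- s]) (flatten [seq c x | x <- t]) =
  word_dist (fun x y => word_dist d (c x) (c y)) s t.
Proof.
move=> c_size; elim: s t => [|x s IH] [|y t] //= => [_|[st]].
  by rewrite /word_dist !big_nil.
by rewrite word_dist_cat ?c_size // IH // word_dist_cons.
Qed.

Notation hamming := (word_dist (fun a b : bool => (a != b) : nat)).

Lemma hypercube_adjE m (x y : m.-tuple bool) :
  hypercube_adj x y = (hamming x y == 1).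
Proof.
rewrite /hypercube_adj -sum1dep_card big_mkcond /word_dist.
rewrite (big_nth (false, false)) size_zip !size_tuple minnn big_mkord.
congr (_ == 1); apply: eq_bigr => i _.
by rewrite nth_zip ?size_tuple //= !(tnth_nth false); case: (_ != _).
Qed.

Lemma hamming_unit_vector (i j m o : nat) :
  hamming [seq p == i | p <- iota o m] [seq p == j | p <- iota o m] =
  if i == j then 0 else (o <= i < o + m) + (o <= j < o + m).
Proof.
elim: m o => [|m IH] o /=.
  by rewrite /word_dist big_nil; case: ifP => // _; lia.
rewrite word_dist_cons IH.
by case: (eqVneq i j) => [->|ij]; [rewrite eqxx | lia].
Qed.

(** * Fibonacci strings *)

Lemma fibonacci_stringE m (x : m.-tuple bool) :
  fibonacci_string x = sorted (fun a b => ~~ (a && b)) x.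
Proof.
apply/forallP/(sortedP false) => [x_fib i|x_sorted i].
  rewrite size_tuple => im; have := x_fib (Ordinal (ltnW im)).
  by move/forallP/(_ (Ordinal im)); rewrite eqxx !(tnth_nth false).
apply/forallP=> j; apply/implyP=> /eqP ij; rewrite !(tnth_nth false) ij.
by apply: x_sorted; rewrite size_tuple -ij.
Qed.

Lemma fibonacci_string_rcons0 m (x : m.-tuple bool) :
  fibonacci_string (rcons_tuple x false) = fibonacci_string x.
Proof.
rewrite !fibonacci_stringE /=; case: (tval x) => //= a s.
by rewrite rcons_path andbF andbT.
Qed.

Section DropFinalZero.
Variable m : nat.

Definition append0 (x : fibonacci_cube m) : fibonacci_cube m.+1 :=
  exist _ (rcons_tuple (val x) false)
    (etrans (fibonacci_string_rcons0 (val x)) (valP x)).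

Lemma append0_embedding : embedding append0.
Proof.
split=> [x y /(congr1 (fun z => tval (val z)))/rcons_inj[xy]|x y].
  by do 2!apply: val_inj.
rewrite /= /induced_adj /= !hypercube_adjE /= -!cats1.
rewrite word_dist_cat ?size_tuple // word_dist_cons.
by rewrite /word_dist big_nil !addn0.
Qed.

Lemma mem_codom_append0 (y : fibonacci_cube m.+1) :
  last false (tval (val y)) = false -> y \in codom append0.
Proof.
move=> y0.
have [x yE] : exists x, val y = rcons_tuple x false :> m.+1.-tuple bool.
  move: (val y : m.+1.-tuple bool) y0; case/tupleP=> a s /= s0.
  by exists (belast_tuple a s); apply: val_inj; rewrite /= -s0 -lastI.
have x_fib : fibonacci_string x.
  by rewrite -fibonacci_string_rcons0 -yE (valP y).
by apply/codomP; exists (exist _ x x_fib); apply: val_inj.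
Qed.
End DropFinalZero.

Lemma embedding_drop_last0 (G : sgraph) m (f : G -> fibonacci_cube m) :
  embedding f -> (forall x, last false (tval (val (f x))) = false) ->
  exists g : G -> fibonacci_cube (m - 1), embedding g.
Proof.
case: m f => [|m] f f_emb f0; first by exists f.
have [|g g_emb _] := embedding_factor f_emb (@append0_embedding m).
  by move=> _ /codomP[x ->]; apply/mem_codom_append0/f0.
by rewrite subn1; exists g.
Qed.

(** * Words in blocks *)

Section BlockWords.
Variables (T : eqType) (x : T).
Implicit Types (w a c bs : seq T) (e y z : T).

Definition block e y : seq T := if y == x then [:: x; e] else [:: y].

Definition block_word e bs : seq T := flatten [seq block e y | y <- bs].

(* One parser for all [e]: after a letter [x] it skips whatever comes next. *)
Fixpoint parse_blocks w : seq T :=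
  if w is y :: w1 then
    y :: (if y != x then parse_blocks w1
          else if w1 is _ :: w2 then parse_blocks w2 else [::])
  else [::].

Lemma block_wordK e : cancel (block_word e) parse_blocks.
Proof.
elim=> //= y bs; rewrite /block_word /= /block.
by case: eqP => [-> /= ->|/eqP/negPf y_x /= ->]; rewrite ?eqxx ?y_x.
Qed.

Lemma block_word_inj e : injective (block_word e).
Proof. exact: can_inj (block_wordK e). Qed.

Lemma block_word_cat e bs bs' :
  block_word e (bs ++ bs') = block_word e bs ++ block_word e bs'.
Proof. by rewrite /block_word map_cat flatten_cat. Qed.

Lemma block_word_double e bs :
  block_word e (x :: bs) = [:: x, e & block_word e bs].
Proof. by rewrite /block_word /= /block eqxx. Qed.

Lemma block_word_single e y bs :
  y != x -> block_word e (y :: bs) = y :: block_word e bs.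
Proof. by rewrite /block_word /= /block => /negPf->. Qed.

Lemma size_block_word e bs : size (block_word e bs) = size bs + count_mem x bs.
Proof.
elim: bs => //= y bs IH; have [->|y_x] := eqVneq y x.
  by rewrite block_word_double /= IH; lia.
by rewrite block_word_single //= IH.
Qed.

(* Only [e] can occur in a block past its first letter. *)
Lemma block_word_split e bs a y c : y != e -> block_word e bs = a ++ y :: c ->
  exists bs1 bs2, a = block_word e bs1 /\ y :: c = block_word e bs2.
Proof.
move=> y_e; elim: bs a => [|z bs IH] a; first by case: a.
case: a => [|t a]; first by move=> E; exists [::], (z :: bs).
have [->|z_x] := eqVneq z x; last first.
  rewrite block_word_single // => -[<- /IH[bs1 [bs2 [-> ->]]]].
  by exists (z :: bs1), bs2; rewrite block_word_single.
rewrite block_word_double => -[<-]; case: a => [[ey]|t' a [<-]].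
  by rewrite ey eqxx in y_e.
move=> /IH[bs1 [bs2 [-> ->]]].
by exists (x :: bs1), bs2; rewrite block_word_double.
Qed.

Lemma block_word_eq_single e bs y c : y != x -> y :: c = block_word e bs ->
  exists bs1, c = block_word e bs1.
Proof.
move=> y_x; case: bs => // z bs; have [->|z_x] := eqVneq z x.
  by rewrite block_word_double => -[yx]; rewrite yx eqxx in y_x.
by rewrite block_word_single // => -[_ ->]; exists bs.
Qed.

Lemma block_word_eq_double e bs c : x :: c = block_word e bs ->
  exists bs1, c = e :: block_word e bs1.
Proof.
case: bs => // z bs; have [->|z_x] := eqVneq z x.
  by rewrite block_word_double => -[->]; exists bs.
by rewrite block_word_single // => -[xz]; rewrite -xz eqxx in z_x.
Qed.

Lemma block_word_replace_single e e' y z bs bs' : y != x -> z != x -> z != e ->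
  factor_replace [:: y] [:: z] (block_word e bs) (block_word e bs') ->
  factor_replace [:: y] [:: z] (block_word e' bs) (block_word e' bs').
Proof.
move=> y_x z_x z_e [a [c [wE w'E]]].
have [bs1 [bs2 [aE zcE]]] := block_word_split z_e w'E.
have [bs3 cE] := block_word_eq_single z_x zcE.
have -> : bs = bs1 ++ y :: bs3.
  apply: (@block_word_inj e).
  by rewrite wE block_word_cat block_word_single // aE cE.
have -> : bs' = bs1 ++ z :: bs3.
  apply: (@block_word_inj e).
  by rewrite w'E block_word_cat block_word_single // aE cE.
exists (block_word e' bs1), (block_word e' bs3).
by rewrite !block_word_cat !block_word_single.
Qed.

Lemma block_word_replace_double e e' y bs bs' : y != x -> e \in [:: y; x] ->
  factor_replace [:: y; y] [:: x; e] (block_word e bs) (block_word e bs') ->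
  factor_replace [:: y; y] [:: x; e'] (block_word e' bs) (block_word e' bs').
Proof.
move=> y_x e_yx [a [c [wE w'E]]].
have [bs1 [bs2 [aE cE]]] :
    exists bs1 bs2, a = block_word e bs1 /\ c = block_word e bs2.
  move: e_yx; rewrite !inE => /orP[] /eqP eE.
    have x_e : x != e by rewrite eE eq_sym.
    have [bs1 [bs3 [aE xecE]]] := block_word_split x_e w'E.
    by have [bs2 [cE]] := block_word_eq_double xecE; exists bs1, bs2.
  have y_e : y != e by rewrite eE.
  have [bs1 [bs3 [aE yycE]]] := block_word_split y_e wE.
  have [bs4 ycE] := block_word_eq_single y_x yycE.
  by have [bs2 cE] := block_word_eq_single y_x ycE; exists bs1, bs2.
have -> : bs = bs1 ++ [:: y, y & bs2].
  apply: (@block_word_inj e).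
  by rewrite wE block_word_cat !block_word_single // aE cE.
have -> : bs' = bs1 ++ x :: bs2.
  apply: (@block_word_inj e).
  by rewrite w'E block_word_cat block_word_double aE cE.
exists (block_word e' bs1), (block_word e' bs2).
by rewrite !block_word_cat block_word_double !block_word_single.
Qed.

Section EvenRuns.
Variable x0 : T.
Hypothesis x0_neq_x : x0 != x.

(* The default [x0] lets the two ends of [w] bound a maximal run. *)
Definition even_runs w : Prop := forall a m c,
  w = a ++ nseq m x ++ c -> last x0 a != x -> head x0 c != x -> ~~ odd m.

Lemma even_runs_block_word bs : even_runs (block_word x bs).
Proof.
elim: bs => [|y bs IH] a m c; first by case: a => //; case: m.
have [->|y_x] := eqVneq y x.
  rewrite block_word_double; case: a => [|z [|t a]] /=.
  - case: m => [|[|m]] //= -[E] _ c_x; first by rewrite -E eqxx in c_x.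
    by rewrite negbK; apply: (IH [::]) E _ c_x.
  - by move=> [<-]; rewrite eqxx.
  - by move=> [_ <- E] a_x; apply: IH E _; case: a a_x => //=; rewrite eqxx.
rewrite block_word_single //; case: a => [|z a] /=.
  by case: m => // m [yx]; rewrite yx eqxx in y_x.
by move=> [_ E] a_x; apply: IH E _; case: a a_x.
Qed.

Lemma parse_blocksK w : even_runs w -> block_word x (parse_blocks w) = w.
Proof.
have [m] := ubnP (size w); elim: m w => // m IH [|y w] //= sz w_even.
have [yx|y_x] := eqVneq y x; last first.
  rewrite block_word_single // IH // => a r c wE a_x c_x.
  apply: (w_even (y :: a) r c) => //=; first by rewrite wE.
  by case: a a_x {wE}.
rewrite {}yx in w_even *; case: w => [|z w] in sz w_even *.
  by have := w_even [::] 1 [::] erefl x0_neq_x x0_neq_x.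
have [zx|z_x] := eqVneq z x; last first.
  by have := w_even [::] 1 (z :: w) erefl x0_neq_x z_x.
rewrite {}zx in w_even *; rewrite block_word_double IH //; first exact: ltnW.
move=> [|t a] r c wE a_x c_x.
  by have := w_even [::] r.+2 c; rewrite wE negbK; apply.
by apply: (w_even [:: x, x, t & a] r c); rewrite ?wE.
Qed.
End EvenRuns.
End BlockWords.

(** * The Munarini graph *)

Section MunariniWords.
Variable k : nat.
Hypothesis k_gt0 : 0 < k.
Local Notation letter := 'I_k.+1.
Local Notation spell := (@block_word letter ord_max).
Implicit Types (u w a c bs : seq letter) (e i j : letter).

Lemma ord0_neq_max : ord0 != ord_max :> letter.
Proof. by rewrite -val_eqE /= eq_sym -lt0n. Qed.

Lemma max_runP n (w : n.-tuple letter) (i j : nat) : j <= n ->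
  reflect (exists a c,
             [/\ tval w = a ++ nseq (j - i) ord_max ++ c, size a = i, i < j,
                 last ord0 a != ord_max & head ord0 c != ord_max])
          (max_run w i j).
Proof.
move=> jn; have w_nth (p : 'I_n) : tnth w p = nth ord0 w p by apply: tnth_nth.
rewrite /max_run; apply: (iffP and3P) => [[ij /forallP run /forallP ends]|].
  have i_size : size (take i w) = i by rewrite size_takel // size_tuple; lia.
  exists (take i w), (drop j w); split=> //.
  - have := @cat_take_factor_drop _ ord0 (nseq (j - i) ord_max) w i.
    rewrite size_nseq subnKC ?size_tuple; last exact: ltnW.
    apply=> // p pij; have pn : i + p < n by lia.
    have := run (Ordinal pn); rewrite w_nth nth_nseq pij /= => /implyP run_p.
    by apply/eqP/run_p; lia.
  - rewrite -nth_last i_size; case: i ij {run i_size} ends => [|i] ij ends.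
      by rewrite take0 ord0_neq_max.
    have pn : i < n by lia.
    by rewrite nth_take //; have := ends (Ordinal pn); rewrite w_nth /= eqxx.
  - rewrite -nth0 nth_drop addn0; case: (ltnP j n) => j_lt.
      by have := ends (Ordinal j_lt); rewrite w_nth /= eqxx orbT.
    by rewrite nth_default ?size_tuple // ord0_neq_max.
case=> a [c [wE a_size ij a_end c_end]]; rewrite -{i}a_size in wE ij *.
split=> //; apply/forallP=> p; apply/implyP.
  move=> /andP[ap pj]; have run_p : p - size a < j - size a by lia.
  by rewrite w_nth wE nth_cat ltnNge ap /= nth_cat size_nseq nth_nseq run_p.
rewrite w_nth wE nth_cat => /orP[] /eqP pE.
  by rewrite -pE ltnSn -[X in nth _ _ X]/(p.+1.-1) pE nth_last.
by rewrite pE ltnNge ltnW //= nth_cat size_nseq ltnn subnn nth0.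
Qed.

Lemma size_spell_tuple n (w : n.-tuple letter) e e' bs :
  tval w = spell e bs -> size (spell e' bs) = n.
Proof.
by move=> wE; rewrite size_block_word -(size_block_word _ e) -wE size_tuple.
Qed.

Lemma pell_stringP n (w : n.-tuple letter) :
  reflect (exists bs, tval w = spell ord_max bs) (pell_string w).
Proof.
apply: (iffP idP) => [/forallP pell|[bs wE]].
  exists (parse_blocks ord_max w).
  rewrite (parse_blocksK ord0_neq_max) // => a m c wE a_end c_end.
  case: m wE => // m wE; have am_n : size a + m.+1 <= n.
    by rewrite -(size_tuple w) wE !size_cat size_nseq addnA leq_addr.
  have a_n : size a < n.+1 by lia.
  have /forallP/(_ (Ordinal (am_n : _ < n.+1)))/implyP := pell (Ordinal a_n).
  rewrite /= addKn; apply; apply/max_runP => //; exists a, c.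
  by rewrite addKn; split=> //; lia.
apply/forallP=> -[i i_lt]; apply/forallP=> -[j jn]; apply/implyP=> /=.
case/max_runP=> // a [c [aE _ _]]; rewrite wE in aE.
exact: (even_runs_block_word ord0_neq_max) aE.
Qed.

(* For [e = ord_max] this is the relation [replace]; for [e = ord0] it is the
   image of [replace] when each block [kk] is written [k0]. *)
Definition munarini_step e w w' : Prop :=
  (exists2 i : letter, 0 < i < k & factor_replace [:: ord0] [:: i] w w') \/
  factor_replace [:: ord0; ord0] [:: ord_max; e] w w'.

Lemma replace_letterP n (w w' : n.-tuple letter) :
  reflect (exists2 i : letter, 0 < i < k & factor_replace [:: ord0] [:: i] w w')
          (replace_letter w w').
Proof.
apply: (iffP existsP) => [[p /and3P[/eqP wp w'p /forallP eqw]]|[i ik]].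
  exists (tnth w' p) => //; apply/(factor_replace_tnth ord0) => //; exists p.
  split=> [|[]//|[]//|q qp]; rewrite ?addn1 ?addn0 -?tnth_nth //.
  apply/eqP/(implyP (eqw q)); apply: contraNneq qp => ->.
  by rewrite leqnn addn1 /=.
case/(factor_replace_tnth ord0) => // p [pn wp w'p eqw].
have pn' : p < n by rewrite addn1 in pn.
have := wp 0 isT; have := w'p 0 isT; rewrite !addn0 /= => w'i w0.
exists (Ordinal pn'); rewrite !(tnth_nth ord0) /= w'i w0 eqxx ik /=.
apply/forallP=> q; apply/implyP=> qp; apply/eqP/eqw; move: qp.
by rewrite -val_eqE /=; lia.
Qed.

Lemma replace_pairP n (w w' : n.-tuple letter) :
  reflect (factor_replace [:: ord0; ord0] [:: ord_max; ord_max] w w')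
          (replace_pair w w').
Proof.
apply: (iffP existsP) => [[p /existsP[p' /and5P[/eqP pE wp wp' w'p]]]|].
  case/andP=> w'p' /forallP eqw.
  apply/(factor_replace_tnth ord0) => //; exists p.
  split=> [|[|[|]]//= _|[|[|]]//= _|q qp];
    rewrite ?addn2 ?addn1 ?addn0 -?pE -?tnth_nth //; try exact/eqP.
  by apply/eqP/(implyP (eqw q)); move: qp; rewrite -!val_eqE /= pE; lia.
case/(factor_replace_tnth ord0) => // p [pn wp w'p eqw].
rewrite addn2 in pn; exists (Ordinal (ltnW pn)).
apply/existsP; exists (Ordinal pn).
have := wp 0 isT; have := wp 1 isT; have := w'p 0 isT; have := w'p 1 isT.
rewrite !(tnth_nth ord0) addn0 addn1 /= => -> -> -> ->; rewrite !eqxx /=.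
apply/forallP=> q; apply/implyP=> qp; apply/eqP/eqw; move: qp.
by rewrite -!val_eqE /=; lia.
Qed.

Lemma replaceP n (w w' : n.-tuple letter) :
  reflect (munarini_step ord_max w w') (replace w w').
Proof.
apply: (iffP orP) => -[/replace_letterP|/replace_pairP]; by [left | right].
Qed.

Lemma munarini_step_spell e e' bs bs' : e \in [:: ord0; ord_max] ->
  munarini_step e (spell e bs) (spell e bs') ->
  munarini_step e' (spell e' bs) (spell e' bs').
Proof.
move=> e_end [[i ik rep]|rep]; last first.
  by right; apply: block_word_replace_double rep => //; apply: ord0_neq_max.
left; exists i => //; apply: block_word_replace_single rep.
- exact: ord0_neq_max.
- by rewrite -val_eqE /=; lia.
- by move: e_end; rewrite !inE -!val_eqE /= => /orP[] /eqP->; lia.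
Qed.

Definition raise_letter u u' : Prop :=
  exists2 i : letter, i != ord0 & factor_replace [:: ord0] [:: i] u u'.

Lemma raise_letter_munarini_step u bs :
  raise_letter u (spell ord0 bs) <-> munarini_step ord0 u (spell ord0 bs).
Proof.
split=> [[i i0 [a [c [uE wE]]]]|[[i ik rep]|[a [c [-> ->]]]]].
- have [iE|i_max] := eqVneq i ord_max; last first.
    left; exists i; last by exists a, c.
    by move: i0 i_max (ltn_ord i); rewrite -!val_eqE /=; lia.
  have [_ [bs2 [_]]] := block_word_split i0 wE.
  rewrite {1}iE => /block_word_eq_double[cs cE].
  by right; exists a, (spell ord0 cs); rewrite uE wE iE cE.
- by exists i => //; rewrite -val_eqE /=; lia.
- by exists ord_max; [rewrite eq_sym ord0_neq_max | exists a, (ord0 :: c)].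
Qed.

Lemma raise_letter_spell bs bs' :
  raise_letter (spell ord0 bs) (spell ord0 bs') <->
  munarini_step ord_max (spell ord_max bs) (spell ord_max bs').
Proof.
rewrite raise_letter_munarini_step.
by split; apply: munarini_step_spell; rewrite !inE eqxx ?orbT.
Qed.

(** * Binary encoding *)

Definition encode u : seq bool := flatten [seq A k (i : letter) | i <- u].

Lemma encode_cons i u : encode (i :: u) = A k i ++ encode u.
Proof. by []. Qed.

Lemma size_A_letter i : size (A k i) = k.
Proof. by rewrite size_A // -ltnS. Qed.

Lemma size_encode u : size (encode u) = k * size u.
Proof.
elim: u => [|i u IH]; first by rewrite muln0.
by rewrite encode_cons size_cat size_A_letter IH mulnS.
Qed.

Lemma A_unit_vector (i : nat) :
  i <= k -> A k i = [seq p == i | p <- iota 1 k].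
Proof.
move=> ik; apply: (@eq_from_nth _ false) => [|p]; rewrite size_A //.
  by rewrite size_map size_iota.
move=> pk; rewrite (nth_map 0) ?size_iota // nth_iota // /A.
case: eqP => i0; first by rewrite nth_nseq pk i0.
rewrite nth_cat size_nseq nth_nseq; case: ltnP => pi; first by lia.
case: (eqVneq p i.-1) => [->|npi]; first by rewrite subnn /=; lia.
have -> : p - i.-1 = (p - i.-1).-1.+1 by lia.
by rewrite /= nth_nseq; case: ifP; lia.
Qed.

Lemma last_A b i : last b (A k i) = (i == ord_max).
Proof.
have k1 : k.-1 < k by rewrite prednK.
rewrite A_unit_vector -1?ltnS // -nth_last size_map size_iota.
rewrite (nth_map 0) ?size_iota //.
by rewrite nth_iota // add1n prednK // -val_eqE eq_sym.
Qed.

Lemma hamming_A i j :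
  hamming (A k i) (A k j) = if i == j then 0 else (i != ord0) + (j != ord0).
Proof.
rewrite !A_unit_vector -1?ltnS // hamming_unit_vector -!val_eqE /=.
by have := ltn_ord i; have := ltn_ord j; case: ifP => //; lia.
Qed.

Lemma hamming_A_eq0 i j : hamming (A k i) (A k j) = 0 <-> i = j.
Proof.
rewrite hamming_A; case: eqP => // ij; split=> // /eqP.
by rewrite addn_eq0 !eqb0 !negbK => /andP[/eqP-> /eqP->].
Qed.

Lemma hamming_A_eq1 i j : hamming (A k i) (A k j) = 1 <->
  (i = ord0 /\ j != ord0) \/ (j = ord0 /\ i != ord0).
Proof.
rewrite hamming_A; split=> [|[[-> j0]|[-> i0]]].
- case: (eqVneq i ord0) => [->|i0].
    by case: (eqVneq j ord0) => [->|]; auto.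
  by case: (eqVneq j ord0) => [-> _|_]; [right | case: ifP].
- by rewrite eq_sym (negPf j0) eqxx.
- by rewrite (negPf i0) eqxx.
Qed.

Lemma hamming_encode u u' : size u = size u' ->
  hamming (encode u) (encode u') =
  word_dist (fun i j => hamming (A k i) (A k j)) u u'.
Proof. exact/word_dist_flatten/size_A_letter. Qed.

Lemma encode_inj u u' : size u = size u' -> encode u = encode u' -> u = u'.
Proof.
move=> uu' E; apply/(word_dist_eq0 hamming_A_eq0 uu').
rewrite -hamming_encode // E.
by apply/word_dist_eq0 => // -[] [].
Qed.

Lemma hamming_encode_eq1 u u' : size u = size u' ->
  hamming (encode u) (encode u') = 1 <-> raise_letter u u' \/ raise_letter u' u.
Proof.
move=> uu'; rewrite hamming_encode // (word_dist_eq1 hamming_A_eq0 uu').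
split=> [[i [j [/hamming_A_eq1]]]|].
  by case=> -[-> ?] [a [c [-> ->]]]; [left; exists j | right; exists i] => //;
    exists a, c.
case=> -[i i0 [a [c [-> ->]]]]; [exists ord0, i | exists i, ord0].
  by split; [apply/hamming_A_eq1; left | exists a, c].
by split; [apply/hamming_A_eq1; right | exists a, c].
Qed.

Lemma encode_spell0 bs :
  encode (spell ord0 bs) = flatten [seq munarini_block i | i <- bs].
Proof.
elim: bs => //= i bs <-; rewrite /munarini_block.
have [->|ni] := eqVneq i ord_max; last by rewrite block_word_single.
by rewrite block_word_double !encode_cons catA.
Qed.

Lemma munarini_string_encodeP s :
  reflect (exists bs, s = encode (spell ord0 bs)) (munarini_string k s).
Proof.
by apply: (iffP (munarini_stringP _ k_gt0)) => -[bs ->]; exists bs;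
  rewrite encode_spell0.
Qed.

Lemma last_encode_spell0 bs : last false (encode (spell ord0 bs)) = false.
Proof.
elim: bs => // i bs IH; have [->|ni] := eqVneq i ord_max.
  rewrite block_word_double !encode_cons !last_cat !last_A.
  by rewrite (negPf ord0_neq_max).
by rewrite block_word_single // encode_cons last_cat last_A (negPf ni).
Qed.

Definition word_code w : seq bool :=
  encode (spell ord0 (parse_blocks ord_max w)).

Lemma word_code_spell bs :
  word_code (spell ord_max bs) = encode (spell ord0 bs).
Proof. by rewrite /word_code block_wordK. Qed.

Lemma size_word_code n (w : n.-tuple letter) :
  pell_string w -> size (word_code w) == k * n.
Proof.
case/pell_stringP=> bs wE.
by rewrite wE word_code_spell size_encode (size_spell_tuple ord0 wE).
Qed.

Lemma munarini_word_code w : munarini_string k (word_code w).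
Proof. by apply/munarini_string_encodeP; exists (parse_blocks ord_max w). Qed.

Lemma word_code_inj n (w w' : n.-tuple letter) :
  pell_string w -> pell_string w' -> word_code w = word_code w' -> w = w'.
Proof.
move=> /pell_stringP[bs wE] /pell_stringP[bs' w'E].
rewrite wE w'E !word_code_spell.
have sz : size (spell ord0 bs) = size (spell ord0 bs').
  by rewrite (size_spell_tuple ord0 wE) (size_spell_tuple ord0 w'E).
move=> /(encode_inj sz)/block_word_inj bsE.
by apply: val_inj; rewrite /= wE w'E bsE.
Qed.

Lemma hamming_word_code n (w w' : n.-tuple letter) :
  pell_string w -> pell_string w' ->
  (hamming (word_code w) (word_code w') == 1) = replace w w' || replace w' w.
Proof.
move=> /pell_stringP[bs wE] /pell_stringP[bs' w'E].
rewrite wE w'E !word_code_spell.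
have sz : size (spell ord0 bs) = size (spell ord0 bs').
  by rewrite (size_spell_tuple ord0 wE) (size_spell_tuple ord0 w'E).
apply/eqP/orP; rewrite (hamming_encode_eq1 sz) !raise_letter_spell -wE -w'E.
  by case=> /replaceP; [left | right].
by case=> /replaceP; [left | right].
Qed.
End MunariniWords.

Section MunariniCode.
Variables (k n : nat) (k_gt0 : 0 < k).

Definition munarini_code (w : munarini_graph n k_gt0) :
    fibonacci_cube (k * n) :=
  let x := Tuple (size_word_code k_gt0 (valP w)) in
  exist _ x (@munarini_string_fibonacci k _ x k_gt0
               (munarini_word_code k_gt0 (val w))).

Lemma munarini_code_embedding : embedding munarini_code.
Proof.
split=> [w w' /(congr1 (fun y => tval (val y))) E|w w'].
  exact/val_inj/(word_code_inj k_gt0 (valP w) (valP w')).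
rewrite /= /induced_adj /= hypercube_adjE.
by rewrite hamming_word_code ?(valP w) ?(valP w').
Qed.

Lemma codom_munarini_code y :
  (y \in codom munarini_code) = munarini_string k (tval (val y)).
Proof.
apply/codomP/(munarini_string_encodeP k_gt0) => [[w ->]|[bs yE]].
  by exists (parse_blocks ord_max (val w)).
have sz : size (block_word ord_max ord_max bs) == n.
  rewrite -(eqn_pmul2l k_gt0) -(size_tuple (val y : _.-tuple bool)) yE.
  by rewrite (size_encode k_gt0) !size_block_word.
have pell : pell_string (Tuple sz) by apply/(pell_stringP k_gt0); exists bs.
exists (exist _ (Tuple sz) pell); do 2!apply: val_inj.
by rewrite /= yE word_code_spell.
Qed.

Lemma last_munarini_code w : last false (tval (val (munarini_code w))) = false.
Proof. exact: last_encode_spell0. Qed.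
End MunariniCode.

Theorem theorem3p1 (k n : nat) (k_gt0 : 0 < k) :
  isomorphic (munarini_graph n k_gt0) (munarini_subcube n k) /\
  (0 < n -> exists H : subgraph (fibonacci_cube (k * n - 1)),
              isomorphic (munarini_graph n k_gt0) H).
Proof.
have code_emb := @munarini_code_embedding k n k_gt0; split=> [|_].
  apply: isomorphic_same_codom code_emb (induced_embedding _) _ => y.
  by rewrite codom_val codom_munarini_code.
have [g g_emb] := embedding_drop_last0 code_emb (@last_munarini_code k n k_gt0).
exact: embedding_isomorphic_subgraph g_emb.
Qed.
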